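(* Let $\mathbb{K}$ be an algebraically closed field of characteristic zero, let $a\in\mathbb{K}^*$, and let $D=(aX+Y)\dfrac{\partial}{\partial X}+aY\dfrac{\partial}{\partial Y}$, a nonzero linear derivation of $\mathbb{K}[X,Y]$. Then \[ \operatorname{Aut}(\mathbb{K}[X,Y])_D=\{(\alpha X+\beta Y,\ \alpha Y)\mid \alpha\in\mathbb{K}^*,\ \beta\in\mathbb{K}\}. \]
   Context: For a derivation $D$ of $\mathbb{K}[X,Y]$, $\operatorname{Aut}(\mathbb{K}[X,Y])_D$ denotes the isotropy group of $D$: the group of all $\mathbb{K}$-algebra automorphisms $\rho$ of $\mathbb{K}[X,Y]$ with $\rho D=D\rho$. A pair $(F,G)$ of polynomials denotes the $\mathbb{K}$-algebra endomorphism $\rho$ of $\mathbb{K}[X,Y]$ with $\rho(X)=F$ and $\rho(Y)=G$. *)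

(* Defs.v *)
From HB Require Import structures.
From mathcomp Require Import all_boot all_order all_algebra ring.
From mathcomp.multinomials Require Import mpoly.

Set Implicit Arguments.
Unset Strict Implicit.
Unset Printing Implicit Defensive.

Import GRing.Theory.
Local Open Scope ring_scope.

Definition varX (K : fieldType) : {mpoly K[2]} := 'X_(0 : 'I_2).
Definition varY (K : fieldType) : {mpoly K[2]} := 'X_(1 : 'I_2).

Definition derivation (K : fieldType) (D : {mpoly K[2]} -> {mpoly K[2]}) : Prop :=
  linear D /\ forall p q, D (p * q) = D p * q + p * D q.

Definition linder (K : fieldType) (a : K) (p : {mpoly K[2]}) : {mpoly K[2]} :=
  (a *: varX K + varY K) * p^`M(0 : 'I_2) + (a *: varY K) * p^`M(1 : 'I_2).

(* Terms are bundled with their structure, so equality of endomorphisms is =1. *)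
Definition kendo (K : fieldType) := {lrmorphism {mpoly K[2]} -> {mpoly K[2]}}.

(* The inverse of a bijective algebra endomorphism
   is an algebra endomorphism, so bijectivity is the automorphism condition. *)
Definition isotropy (K : fieldType) (D : {mpoly K[2]} -> {mpoly K[2]})
    (rho : kendo K) : Prop :=
  bijective rho /\ rho \o D =1 D \o rho.

Definition pair_endo (K : fieldType) (F G : {mpoly K[2]}) : kendo K :=
  comp_mpoly [tuple F; G].

Lemma pair_endoX (K : fieldType) (F G : {mpoly K[2]}) :
  pair_endo F G (varX K) = F.
Proof. by rewrite /= comp_mpolyXU. Qed.

Lemma pair_endoY (K : fieldType) (F G : {mpoly K[2]}) :
  pair_endo F G (varY K) = G.
Proof. by rewrite /= comp_mpolyXU. Qed.

Lemma pair_endoP (K : fieldType) (F G : {mpoly K[2]}) (rho : kendo K) :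
  rho =1 pair_endo F G <-> rho (varX K) = F /\ rho (varY K) = G.
Proof.
split=> [e | [eX eY] p]; first by rewrite !e pair_endoX pair_endoY.
rewrite [p in LHS]mpolyE [p in RHS]mpolyE !linear_sum.
apply: eq_bigr => m _; rewrite !linearZ /=; congr (_ *: _).
rewrite comp_mpolyX mpolyXE_id rmorph_prod !big_ord_recl !big_ord0 /=.
rewrite !rmorphXn !(tnth_nth 0) /= -[in RHS]eX -[in RHS]eY !mulr1.
by congr (_ * rho 'X__ ^+ m _); apply: val_inj.
Qed.

Lemma linder_derivation (K : fieldType) (a : K) : derivation (linder a).
Proof.
split=> [c p q | p q].
  rewrite /linder !linearP !mulrDr -!scalerAr scalerDr.
  by rewrite addrACA.
rewrite /linder !mderivM; ring.
Qed.

Lemma linderX (K : fieldType) (a : K) :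
  linder a (varX K) = a *: varX K + varY K.
Proof.
rewrite /linder /varX !mderivX !mnm1E /= scale1r scale0r mulr0 addr0.
by rewrite -[X in (X - _)%MM]add0m addmK mpolyX0 mulr1.
Qed.

Lemma linderY (K : fieldType) (a : K) : linder a (varY K) = a *: varY K.
Proof.
rewrite /linder /varY !mderivX !mnm1E /= scale1r scale0r mulr0 add0r.
by rewrite -[X in (X - _)%MM]add0m addmK mpolyX0 mulr1.
Qed.

(* Main.v *)
(** In the coefficients [p_(i,j)] of [X^i Y^j], the equation [D p = a p + c Y]
    reads [a (i + j - 1) p_(i,j) + (i + 1) p_(i+1,j-1) = c [(i,j) = (0,1)]].
    Induction on [j] kills every coefficient with [i + j != 1], and the
    coefficient of [Y] gives [p_(1,0) = c], so that [p = c X + beta Y].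
    If [rho] commutes with [D], then [rho Y] satisfies this equation with
    [c = 0], say [rho Y = alpha Y], and [rho X] satisfies it with [c = alpha]. *)

Require Import Defs.
From mathcomp Require Import all_boot all_order all_algebra ring.
From mathcomp.multinomials Require Import mpoly.

Import GRing.Theory.
Local Open Scope ring_scope.

(** Constants and variables generate the polynomial algebra: each monomial is a product of powers of
    variables. This reduces identities between morphisms, or between derivations composed with them,
    to the variables. *)
Lemma mpoly_alg_ind (n : nat) (R : comNzRingType) (P : {mpoly R[n]} -> Prop) :
  (forall c, P c%:MP) -> (forall i, P 'X_i) ->
  (forall p q, P p -> P q -> P (p + q)) ->
  (forall p q, P p -> P q -> P (p * q)) -> forall p, P p.
Proof.
move=> PC PX PD PM; elim/mpolyind => [|c m p _ _ Pp]; first by rewrite -mpolyC0.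
apply: (PD) Pp; rewrite -mul_mpolyC; apply: (PM) => //.
rewrite mpolyXE_id; elim/big_ind: _ => [|p1 p2|i _]; first exact: (PC 1).
  exact: PM.
by elim: (m i) => [|k IHk]; [exact: (PC 1) | rewrite exprS; apply: PM].
Qed.

Lemma mcoeff_mulX_eq0 (n : nat) (R : comNzRingType) (i : 'I_n)
    (p : {mpoly R[n]}) (m : 'X_{1..n}) :
  m i = 0%N -> ('X_i * p)@_m = 0.
Proof.
move=> mi0; elim/mpolyind: p => [|c m' p _ _ IHp]; first by rewrite mulr0 mcoeff0.
rewrite mulrDr mcoeffD IHp addr0 -scalerAr mcoeffZ -mpolyXD mcoeffX.
case: eqP => [e|_]; last by rewrite mulr0.
by move: mi0; rewrite -e mnmDE mnm1E eqxx.
Qed.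

Lemma mcoeff_mulX (n : nat) (R : comNzRingType) (i : 'I_n)
    (p : {mpoly R[n]}) (m : 'X_{1..n}) :
  ('X_i * p)@_(m + U_(i)) = p@_m.
Proof. by rewrite mulrC addmC mcoeffMX. Qed.

Lemma mnm_addU (n : nat) (i : 'I_n) (m : 'X_{1..n}) :
  m i != 0%N -> exists m', m = (m' + U_(i))%MM.
Proof. by move=> mi; exists (m - U_(i))%MM; rewrite submK // lep1mP. Qed.

Lemma mcoeff_mulX_mderiv (n : nat) (R : comNzRingType) (i : 'I_n)
    (p : {mpoly R[n]}) (m : 'X_{1..n}) :
  ('X_i * p^`M(i))@_m = p@_m *+ m i.
Proof.
have [mi0|/mnm_addU[m' ->]] := eqVneq (m i) 0%N.
  by rewrite mcoeff_mulX_eq0 // mi0.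
by rewrite mcoeff_mulX mcoeff_deriv mnmDE mnm1E eqxx addn1.
Qed.

Lemma linderD (K : fieldType) (a : K) : {morph linder a : p q / p + q}.
Proof.
by move=> p q; have [linD _] := linder_derivation a; rewrite -[p]scale1r linD !scale1r.
Qed.

Lemma linderZ (K : fieldType) (a c : K) (p : {mpoly K[2]}) :
  linder a (c *: p) = c *: linder a p.
Proof. by rewrite /linder !mderivZ scalerDr -!scalerAr. Qed.

(** The derivation is [a] times the Euler operator [X d/dX + Y d/dY], which multiplies each
    coefficient by the degree of its monomial, plus the nilpotent part [Y d/dX]. *)
Lemma mcoeff_linder (K : fieldType) (a : K) (p : {mpoly K[2]}) (m : 'X_{1..2}) :
  (linder a p)@_m = a * p@_m *+ mdeg m + (varY K * p^`M(0))@_m.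
Proof.
rewrite /linder mulrDl -!scalerAl !mcoeffD !mcoeffZ !mcoeff_mulX_mderiv.
rewrite addrAC -mulrDr -mulrnDr mdegE !big_ord_recl big_ord0 addn0 mulrnAr.
by congr (_ * _ *+ (_ + m _) + _); apply: val_inj.
Qed.

Lemma linder_eigen (K : fieldType) (a : K) (p : {mpoly K[2]}) (c : K) :
  [pchar K] =i pred0 -> a != 0 ->
  linder a p = a *: p + c *: varY K ->
  p = c *: varX K + p@_U_(1) *: varY K.
Proof.
move=> /pcharf0P K_char0 a_neq0 Dp.
have coefE m : a * p@_m *+ mdeg m + (varY K * p^`M(0))@_m
             = a * p@_m + c * (U_(1)%MM == m)%:R.
  by rewrite -mcoeff_linder Dp mcoeffD !mcoeffZ mcoeffX.
(* Outside degree 1 the term [c Y] does not contribute, so [coefE] becomes [a (deg m - 1) p_m = 0]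
   once the contribution of [Y d/dX] vanishes. In degree 0 the factor is [-1]; in degree at least 2
   it is nonzero by characteristic zero. *)
have coef_eq0_step m :
    mdeg m != 1%N -> (varY K * p^`M(0))@_m = 0 -> p@_m = 0.
  move=> deg_m Ym; have deg_m1 : (mdeg m)%:R - 1 != 0 :> K.
    case: (mdeg m) deg_m => [_|d]; first by rewrite sub0r oppr_eq0 oner_eq0.
    by rewrite eqSS -natr1 addrK K_char0.
  have /negPf U1m : U_(1)%MM != m.
    by apply: contraNneq deg_m => <-; rewrite mdeg1.
  have: a * p@_m * ((mdeg m)%:R - 1) = 0.
    by rewrite mulrBr mulr1 mulr_natr -[_ *+ _]addr0 -Ym coefE U1m mulr0 addr0 subrr.
  by move/eqP; rewrite !mulf_eq0 (negPf a_neq0) (negPf deg_m1) orbF => /eqP.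
have coef_eq0 m : mdeg m != 1%N -> p@_m = 0.
  (* Strong induction on the exponent of [Y]: for [m = m' + U_(1)], the coefficient of [Y dp/dX] at
     [m] is a multiple of that of [p] at [m' + U_(0)], which has the same degree and one [Y]
     fewer. *)
  have [j] := ubnP (m 1); elim: j m => // j IHj m lt_mj deg_m.
  apply: coef_eq0_step => //.
  have [m0|/mnm_addU[m' em]] := eqVneq (m 1) 0%N; first exact: mcoeff_mulX_eq0.
  rewrite em mcoeff_mulX mcoeff_deriv IHj ?mul0rn //.
    by move: lt_mj; rewrite em !mnmDE !mnm1E eqxx addn1 addn0.
  by move: deg_m; rewrite em !mdegD !mdeg1.
have pU0 : p@_U_(0) = c.
  (* At the monomial [Y], of degree 1, the terms [a p_Y] cancel and [p_X = c] remains. *)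
  move: (coefE (0 + U_(1))%MM); rewrite mcoeff_mulX mcoeff_deriv !add0m mnm0E.
  by rewrite mdeg1 eqxx mulr1 !mulr1n => /addrI.
apply/mpolyP => m; rewrite mcoeffD !mcoeffZ !mcoeffX.
have [/eqP/mdeg1P[i /eqP->]|deg_m] := eqVneq (mdeg m) 1%N; last first.
  have neqU i : (U_(i)%MM == m) = false.
    by apply: contraNF deg_m => /eqP<-; rewrite mdeg1.
  by rewrite coef_eq0 // !neqU !mulr0 addr0.
rewrite !eq_mnm1; case: i => -[|[|//]] lti.
  rewrite (_ : Ordinal lti = 0); last exact: val_inj.
  by rewrite pU0 eqxx mulr1 mulr0 addr0.
rewrite (_ : Ordinal lti = 1); last exact: val_inj.
by rewrite eqxx mulr1 mulr0 add0r.
Qed.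

(** Both composites are linear, kill constants and satisfy the twisted Leibniz rule
    [d(pq) = d(p) rho(q) + rho(p) d(q)], so they are determined by their values on [X] and [Y]. *)
Lemma kendo_linder_comm (K : fieldType) (a : K) (rho : kendo K) :
  rho (linder a (varX K)) = linder a (rho (varX K)) ->
  rho (linder a (varY K)) = linder a (rho (varY K)) ->
  rho \o linder a =1 linder a \o rho.
Proof.
move=> DX DY; have [_ leibD] := linder_derivation a.
have DC c : linder a c%:MP = 0 by rewrite /linder !mderivC !mulr0 addr0.
apply: mpoly_alg_ind => [c|i|p q /= IHp IHq|p q /= IHp IHq] /=.
- by rewrite -alg_mpolyC linearZ /= rmorph1 alg_mpolyC DC linear0.
- case: i => -[|[|//]] lti.
    by rewrite (_ : Ordinal lti = 0); last exact: val_inj.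
  by rewrite (_ : Ordinal lti = 1); last exact: val_inj.
- by rewrite linderD (rmorphD rho (linder a p)) (rmorphD rho p) linderD /= IHp IHq.
rewrite leibD (rmorphD rho (linder a p * q)) (rmorphM rho p) !rmorphM /=.
by rewrite leibD IHp IHq.
Qed.

Lemma kendo_id (K : fieldType) (rho : kendo K) :
  rho (varX K) = varX K -> rho (varY K) = varY K -> rho =1 id.
Proof.
move=> eX eY; elim/mpoly_alg_ind => [c|i|p q IHp IHq|p q IHp IHq] /=.
- by rewrite -alg_mpolyC linearZ /= rmorph1.
- case: i => -[|[|//]] lti.
    by rewrite (_ : Ordinal lti = 0); last exact: val_inj.
  by rewrite (_ : Ordinal lti = 1); last exact: val_inj.
- by rewrite rmorphD /= IHp IHq.
by rewrite rmorphM /= IHp IHq.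
Qed.

Lemma pair_endo_bij (K : fieldType) (alpha beta : K) : alpha != 0 ->
  bijective (pair_endo (alpha *: varX K + beta *: varY K) (alpha *: varY K)).
Proof.
move=> alpha_neq0; set rho := pair_endo _ _.
(* The coefficients come from inverting the triangular matrix with rows [(alpha, beta)] and
   [(0, alpha)]. *)
pose rho' := pair_endo (alpha^-1 *: varX K - (beta / alpha ^+ 2) *: varY K)
                       (alpha^-1 *: varY K).
have rhoX : rho (varX K) = _ := pair_endoX _ _.
have rhoY : rho (varY K) = _ := pair_endoY _ _.
have rho'X : rho' (varX K) = _ := pair_endoX _ _.
have rho'Y : rho' (varY K) = _ := pair_endoY _ _.
(* Only the values on [X] and [Y] are kept from here on; they determine both composites by
   [kendo_id]. *)
move: rho rho' rhoX rhoY rho'X rho'Y => rho rho' rhoX rhoY rho'X rho'Y.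
exists rho'.
  apply: (@kendo_id _ (rho' \o rho)) => /=.
    rewrite rhoX linearD !linearZ /= rho'X rho'Y scalerBr !scalerA divff //.
    rewrite (_ : alpha * (beta / alpha ^+ 2) = beta / alpha); last by field.
    by rewrite scale1r subrK.
  by rewrite rhoY linearZ /= rho'Y scalerA divff // scale1r.
apply: (@kendo_id _ (rho \o rho')) => /=.
  rewrite rho'X linearB !linearZ /= rhoX rhoY scalerDr scalerN !scalerA mulVf //.
  rewrite (_ : beta / alpha ^+ 2 * alpha = alpha^-1 * beta); last by field.
  by rewrite scale1r addrK.
by rewrite rho'Y linearZ /= rhoY scalerA mulVf // scale1r.
Qed.

Theorem theorem3p9 (K : closedFieldType) (K_char0 : [pchar K] =i pred0)
    (a : K) (a_neq0 : a != 0) (rho : kendo K) :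
  isotropy (linder a) rho <->
  exists alpha beta : K,
    alpha != 0 /\
    rho =1 pair_endo (alpha *: varX K + beta *: varY K) (alpha *: varY K).
Proof.
split=> [[rho_bij rhoD] | [alpha [beta [alpha_neq0 rhoE]]]]; last first.
  split; first by apply: eq_bij (pair_endo_bij _ alpha beta alpha_neq0) _ _ => p.
  have [rhoX rhoY] := (pair_endoP _ _ _).1 rhoE.
  (* On [X] both sides equal [a alpha X + (alpha + a beta) Y]; on [Y] both equal [a alpha Y]. *)
  apply: kendo_linder_comm; rewrite (linderX, linderY) ?linearD linearZ /= ?rhoX rhoY.
    rewrite linderD !linderZ linderX linderY !scalerDr !scalerA.
    by rewrite [alpha * a]mulrC [beta * a]mulrC addrAC.
  by rewrite linderZ linderY !scalerA mulrC.
have rhoY : rho (varY K) = (rho (varY K))@_U_(1) *: varY K.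
  rewrite [LHS](@linder_eigen _ a _ 0) ?scale0r ?add0r //.
  by rewrite addr0 -[LHS]rhoD /= linderY linearZ.
set alpha := _@__ in rhoY.
have rhoX := @linder_eigen _ a (rho (varX K)) alpha K_char0 a_neq0.
exists alpha, (rho (varX K))@_U_(1); split; last first.
  apply/pair_endoP; split=> //; apply: rhoX.
  by rewrite -[LHS]rhoD /= linderX linearD linearZ /= rhoY.
(* If [alpha = 0], then [rho Y = 0 = rho 0], and injectivity of [rho] would force [Y = 0]. *)
apply/eqP => alpha0; move: rhoY; rewrite alpha0 scale0r -(linear0 rho).
move/(bij_inj rho_bij)/(congr1 (mcoeff U_(1))).
by rewrite mcoeff0 mcoeffXU eqxx => /eqP; rewrite oner_eq0.
Qed.
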